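(* Let $K=\mathbb{F}_q$ be a finite field with $q\neq 2$. If $G$ is a Hamiltonian bipartite graph with $2k$ vertices and $X$ is the projective algebraic toric set parameterized by the edges of $G$ (defined in the context), then $${\rm reg}(S/I(X))=(k-1)(q-2).$$
   Context: Graphs are finite and simple. A graph is Hamiltonian if it contains a cycle passing through all its vertices. Let $G$ have vertex set $\{y_1,\ldots,y_n\}$ and edges $f_1,\ldots,f_s$, and let $v_i=e_j+e_k\in\{0,1\}^n$ be the characteristic vector of $f_i=\{y_j,y_k\}$. Put $K^*=K\setminus\{0\}$ and, for $x\in (K^* )^n$, $x^{v_i}=x_1^{v_{i1}}\cdots x_n^{v_{in}}$. The projective algebraic toric set parameterized by the edges of $G$ is $X=\{[(x^{v_1},\ldots,x^{v_s})] : x\in (K^* )^n\}\subset\mathbb{P}^{s-1}$, the projective space over $K$. $S=K[t_1,\ldots,t_s]$ is a polynomial ring with the standard grading, and $I(X)$ is the ideal of $S$ generated by the homogeneous polynomials vanishing on $X$. The Hilbert function is $H_X(d)=\dim_K (S/I(X))_d$; it is constant, equal to $|X|$, for $d\gg 0$, and ${\rm reg}(S/I(X))$ is the least integer $p\geq 0$ such that $H_X(d)=|X|$ for all $d\geq p$ (this equals the Castelnuovo-Mumford regularity). *)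

(* Defs.v *)
From HB Require Import structures.
From mathcomp Require Import all_boot all_order all_algebra.
From mathcomp Require Import mpoly.

Set Implicit Arguments.
Unset Strict Implicit.
Unset Printing Implicit Defensive.

Import GRing.Theory.
Local Open Scope ring_scope.

Section Graphs.
Variables (V : finType) (adj : rel V).

Definition edges : {set {set V}} :=
  [set [set p.1; p.2] | p : V * V & adj p.1 p.2].

(* The size condition excludes u, v, u for an edge {u, v}, which [cycle] would
   accept. *)
Definition hamiltonian : Prop :=
  exists c : seq V, [/\ (2 < size c)%N, cycle adj c, uniq c & forall v, v \in c].

Definition bipartite : Prop :=
  exists A : {set V}, forall u v, adj u v -> (u \in A) != (v \in A).

End Graphs.

Section Projective.
Variables (K : finFieldType) (s : nat).

(* The point [v] of the projective space, as the set of its representatives. *)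
Definition proj_pt (v : 'rV[K]_s) : {set 'rV[K]_s} :=
  [set c *: v | c : K & c != 0].

Definition proj_space : {set {set 'rV[K]_s}} :=
  [set proj_pt v | v : 'rV[K]_s & v != 0].

Definition vanishes_on (X : {set {set 'rV[K]_s}}) (p : {mpoly K[s]}) : Prop :=
  forall P, P \in X -> forall v, v \in P -> p.@[v ord0] = 0.

End Projective.

Section ToricSet.
Variables (K : finFieldType) (V : finType) (s : nat) (f : 'I_s -> {set V}).

Definition charvec (A : {set V}) (y : V) : nat := (y \in A).

Definition monom (x : {ffun V -> K}) (a : V -> nat) : K := \prod_y x y ^+ a y.

Definition toric_set : {set {set 'rV[K]_s}} :=
  [set proj_pt (\row_(i < s) monom x (charvec (f i)))
     | x : {ffun V -> K} & [forall y, x y != 0]].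

Lemma toric_set_proj : (0 < s)%N -> toric_set \subset proj_space K s.
Proof.
move=> s_gt0; apply/subsetP => P /imsetP[x]; rewrite inE => /forallP x0 ->.
apply: imset_f; rewrite inE; apply/eqP => /rowP /(_ (Ordinal s_gt0)).
rewrite !mxE => /eqP; apply/negP/prodf_neq0 => y _.
by rewrite expf_neq0.
Qed.

End ToricSet.

Definition ideal_gen (R : comNzRingType) (B : R -> Prop) (p : R) : Prop :=
  exists2 l : seq (R * R), (forall hg, hg \in l -> B hg.2)
                         & p = \sum_(hg <- l) hg.1 * hg.2.

(* For subspaces U and W of V, the image of U in V / W has dimension m: the
   classes of b_0, ..., b_(m-1) form a basis of it. *)
Definition dim_mod (K : fieldType) (V : lmodType K) (U W : V -> Prop) (m : nat)
    : Prop :=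
  exists b : 'I_m -> V,
    [/\ forall i, U (b i),
        forall c : 'I_m -> K, W (\sum_i c i *: b i) -> forall i, c i = 0
      & forall u, U u -> exists c : 'I_m -> K, W (u - \sum_i c i *: b i)].

Section Hilbert.
Variables (K : finFieldType) (s : nat) (X : {set {set 'rV[K]_s}}).

Definition vanishing_ideal : {mpoly K[s]} -> Prop :=
  ideal_gen (fun g => (exists d, g \is d.-homog) /\ vanishes_on X g).

(* H_X(d) = m; such an m is unique, see [hilbert_uniq]. *)
Definition hilbert (d m : nat) : Prop :=
  dim_mod (fun p : {mpoly K[s]} => p \is d.-homog) vanishing_ideal m.

(* reg(S/I(X)) = r. *)
Definition regularity (r : nat) : Prop :=
  let stable p := forall d, (p <= d)%N -> hilbert d #|X| in
  stable r /\ forall p, stable p -> (r <= p)%N.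

End Hilbert.

Lemma dim_mod_uniq (K : fieldType) (V : lmodType K) (U W : V -> Prop) m m' :
    W 0 -> (forall a u v, W u -> W v -> W (a *: u + v)) ->
  dim_mod U W m -> dim_mod U W m' -> m = m'.
Proof.
move=> W0 WD; have key n n' : dim_mod U W n -> dim_mod U W n' -> (n <= n')%N.
  move=> [b [Ub bfree _]] [b' [_ _ b'gen]].
  have [A WA] : exists A : 'I_n -> {ffun 'I_n' -> K},
      forall i, W (b i - \sum_j A i j *: b' j).
    have ex i : exists c : {ffun 'I_n' -> K}, W (b i - \sum_j c j *: b' j).
      have [c Wc] := b'gen _ (Ub i); exists [ffun j => c j].
      by under eq_bigr do rewrite ffunE.
    by have [A HA] := fin_all_exists ex; exists A.
  pose M := \matrix_(i, j) A i j.
  suff /eqP <- : row_free M by apply: rank_leq_col.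
  rewrite -kermx_eq0; apply/rowV0P => u /sub_kermxP uM0.
  apply/rowP => i; rewrite mxE; apply: (bfree (fun i => u 0 i)).
  have -> : \sum_i u 0 i *: b i = \sum_i u 0 i *: (b i - \sum_j A i j *: b' j).
    under [RHS]eq_bigr do rewrite scalerBr scaler_sumr.
    rewrite sumrB exchange_big /= [X in _ - X]big1 ?subr0 // => j _.
    under eq_bigr do rewrite scalerA.
    rewrite -scaler_suml; have /rowP/(_ j) := uM0; rewrite !mxE.
    by under eq_bigr do rewrite mxE; move->; rewrite scale0r.
  by apply: (big_rec W) => // k v _ Wv; apply: WD.
by move=> h h'; apply/eqP; rewrite eqn_leq !key.
Qed.

Lemma hilbert_uniq (K : finFieldType) s (X : {set {set 'rV[K]_s}}) d m m' :
  hilbert X d m -> hilbert X d m' -> m = m'.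
Proof.
apply: dim_mod_uniq => [|a u v [l Bl ->] [l' Bl' ->]].
  by exists [::] => //; rewrite big_nil.
exists ([seq (a *: hg.1, hg.2) | hg <- l] ++ l') => [hg|].
  by rewrite mem_cat => /orP[/mapP[hg' /Bl ? ->]|/Bl'].
rewrite big_cat big_map scaler_sumr /=; congr (_ + _).
by apply: eq_bigr => hg _; rewrite scalerAl.
Qed.

(* Main.v *)
Require Import Defs.
(* mpoly comes first: its [symmetric] must not shadow the one for relations. *)
From mathcomp Require Import mpoly.
From mathcomp Require Import all_boot all_order all_algebra.
From mathcomp Require Import finfield zify.

(* H_X(d) = |X| means that forms of degree d interpolate at the points of X.
   Let m = q - 1, let A be one side of the bipartition, and let sigma be the
   successor along the Hamiltonian cycle; put z_y = x_y x_(sigma y).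

   Upper bound: the sum of z^c over exponents c modulo m with |c| = d (mod m)
   vanishes unless all z_y agree, that is, unless x represents the point
   (1 : ... : 1); dividing z by its value at another point moves the support
   there. Since \prod_(y in A) z_y = \prod_(y notin A) z_y, the class of c may
   be shifted by t on A and by -t off A. The total of the reduced exponents
   averages to k (m - 1) over t and is congruent to d, so for
   d >= (k - 1) (m - 1) some shift has total at most d; hence z^c is the value
   of a monomial of degree d in the edges of the cycle.

   Lower bound: fix a0 in A and let x range over the torus points equal to 1
   off A \ {a0}; only x = 1 represents (1 : ... : 1). The functional
   p |-> \sum_x (\prod_(y in A \ {a0}) x_y) p(x) kills a monomial unless all its
   degrees on A \ {a0} are -1 modulo m, which forces d >= (k - 1) (m - 1),
   whereas a form separating (1 : ... : 1) has nonzero image. *)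

Set Implicit Arguments.
Unset Strict Implicit.
Unset Printing Implicit Defensive.

Import GRing.Theory.

(** * Power sums and geometric sums over a finite field *)

Section FiniteField.
Local Open Scope ring_scope.
Variable K : finFieldType.
Let m := #|K|.-1.

Lemma card_finField_pred_gt0 : (0 < m)%N.
Proof. by rewrite /m -ltnS (ltn_predK (finNzRing_gt1 K)) finNzRing_gt1. Qed.

Lemma expf_card_pred (u : K) : u != 0 -> u ^+ m = 1.
Proof.
move=> u0; apply: (mulfI u0).
by rewrite -exprS (ltn_predK (finNzRing_gt1 K)) expf_card mulr1.
Qed.

Lemma natr_card_pred : m%:R = -1 :> K.
Proof.
apply/eqP; rewrite -subr_eq0 opprK natr1 (ltn_predK (finNzRing_gt1 K)).
(* Translation by 1 permutes [K], so adding [#|K|] to the sum of all elements leaves it unchanged;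
   hence [#|K|] is 0 in [K]. *)
rewrite -(inj_eq (addrI (\sum_(u : K) u))) addr0 {2}(reindex_inj (addIr 1)) /=.
by rewrite big_split /= sumr_const cardT -cardE.
Qed.

Lemma geometric_sum_card_pred (u : K) : u != 0 ->
  \sum_(a < m) u ^+ a = - (u == 1)%:R.
Proof.
move=> u0; have [-> | u1] := eqVneq u 1.
  under eq_bigr do rewrite expr1n.
  by rewrite sumr_const card_ord natr_card_pred.
apply: (@mulfI _ (u - 1)); first by rewrite subr_eq0.
by rewrite -subrX1 expf_card_pred // subrr oppr0 mulr0.
Qed.

(** Multiplication by a unit g permutes the units and scales the sum by g^n. Some g has g^n != 1:
    otherwise X^(n mod m) - 1 would have m roots, more than its degree. *)
Lemma sum_expf_unit (n : nat) : ~~ (m %| n)%N ->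
  \sum_(u : K | u != 0) u ^+ n = 0.
Proof.
move=> mn; have [g g0 gn] : exists2 g : K, g != 0 & g ^+ n != 1.
  apply/exists_inP; apply: contraNT mn => /exists_inPn /= all1.
  rewrite /dvdn; have [//|n0] := posnP (n %% m)%N.
  have sizeP := size_XnsubC (1 : K) n0.
  have p0 : 'X^(n %% m) - 1%:P != 0 :> {poly K} by rewrite -size_poly_eq0 sizeP.
  have roots : all (root ('X^(n %% m) - 1%:P)) (enum [pred u : K | u != 0]).
    apply/allP => u; rewrite mem_enum /= => u0; rewrite rootE !hornerE.
    by rewrite expr_mod ?expf_card_pred // subr_eq0; apply/negPn/all1.
  have := max_poly_roots p0 roots (enum_uniq _).
  rewrite -cardE (eq_card (_ : _ =i predC1 0)) // cardC1 -/m sizeP ltnS.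
  by rewrite leqNgt ltn_pmod ?card_finField_pred_gt0.
apply: (@mulfI _ (1 - g ^+ n)); first by rewrite subr_eq0 eq_sym.
apply/eqP; rewrite mulr0 mulrBl mul1r subr_eq0; apply/eqP.
rewrite {1}(reindex_inj (mulfI g0)) /= mulr_sumr; apply: eq_big => u.
  by rewrite mulf_eq0 (negPf g0).
by rewrite exprMn.
Qed.

End FiniteField.

(** * Shifting exponents modulo m on the two sides of a bipartition *)

Section Exponents.

Lemma sum_modn_shift (m c : nat) :
  \sum_(0 <= t < m) (c + t) %% m = \sum_(0 <= t < m) t.
Proof.
elim: c => [|c IHc].
  by apply: eq_big_nat => t /andP[_ tm]; rewrite add0n modn_small.
rewrite -{}IHc; case: m => [|m]; first by rewrite !big_geq.
rewrite big_nat_recr // [RHS]big_nat_recl //= addn0 addnC; congr (_ + _).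
  by rewrite addSnnS modnDr.
by apply: eq_bigr => t _; rewrite addSnnS.
Qed.

Variables (V : finType) (A : {set V}) (k : nat).
Hypotheses (cardA : #|A| = k) (cardCA : #|~: A| = k).

(** [m - t] plays the role of -t modulo [m], keeping exponents natural. *)
Definition exponent_shift (m : nat) (c : V -> nat) (t : nat) (y : V) : nat :=
  (c y + (if y \in A then t else m - t)) %% m.

Lemma sum_exponent_shift_mod m c t : t <= m ->
  \sum_y exponent_shift m c t y = \sum_y c y %[mod m].
Proof.
move=> tm; rewrite modn_summ big_split /= [X in _ + X](bigID (mem A)) /=.
rewrite [X in _ + (X + _)](eq_bigr (fun=> t)) => [|y ->] //.
rewrite [X in _ + (_ + X)](eq_bigr (fun=> m - t)) => [|y /negPf->] //.
rewrite !sum_nat_const cardA (eq_card (_ : _ =i ~: A)) => [|y].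
  by rewrite cardCA -mulnDr subnKC // -modnDmr modnMl addn0.
by rewrite !inE.
Qed.

(** At each of the 2k vertices the shifted exponent runs once through all residues, contributing m(m
    - 1)/2. *)
Lemma sum_sum_exponent_shift m c :
  \sum_(0 <= t < m) \sum_y exponent_shift m c t y = k * (m * m.-1).
Proof.
rewrite exchange_big /=.
rewrite (eq_bigr (fun=> 'C(m, 2))) => [|y _]; last first.
  rewrite /exponent_shift -bin2_sum; case: (y \in A).
    exact: sum_modn_shift.
  (* Reversing the range turns [m - t] into [t.+1], and the extra 1 is absorbed into the offset. *)
  rewrite -(sum_modn_shift m (c y).+1) big_nat_rev /=.
  by apply: eq_big_nat => t; rewrite add0n => /andP[_ tm]; rewrite subKn // addSnnS.
rewrite sum_nat_const -(cardsC A) cardA cardCA addnn -muln2 -mulnA.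
by rewrite -mul_bin_diag bin1.
Qed.

(* Over all t the sums average to k (m - 1), and they are congruent to d
   modulo m: if each exceeded d, each would be at least d + m, which is more
   than k (m - 1). *)
Lemma exponent_shift_small (m d : nat) (c : V -> nat) : 0 < m ->
    \sum_y c y = d %[mod m] -> (k - 1) * m.-1 <= d ->
  exists2 t, t < m & \sum_y exponent_shift m c t y <= d.
Proof.
move=> m0 cd kd; suff /existsP[t small] : [exists t : 'I_m,
    \sum_y exponent_shift m c t y <= d] by exists t.
apply: contraT; rewrite negb_exists => /forallP /= big.
suff : m * (d + m) <= k * (m * m.-1) by nia.
rewrite -(sum_sum_exponent_shift m c) big_mkord -[X in X * _](card_ord m).
rewrite -sum_nat_const; apply: leq_sum => t _.
have := big t; rewrite -ltnNge => dlt.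
have : m %| \sum_y exponent_shift m c t y - d.
  by rewrite -eqn_mod_dvd ?(ltnW dlt) // sum_exponent_shift_mod ?cd // ltnW.
by move=> /dvdn_leq; rewrite subn_gt0 => /(_ dlt); lia.
Qed.
End Exponents.

Section ToricExponents.
Local Open Scope ring_scope.
Variables (K : finFieldType) (V : finType) (A : {set V}) (k d : nat).
Hypotheses (cardA : #|A| = k) (cardCA : #|~: A| = k).
Let m := #|K|.-1.

(** A small shift multiplies the value by the t-th and (m - t)-th powers of two equal products, that
    is by an m-th power, which is 1. The missing degree is a multiple of m and is put on [y0], again
    without effect. *)
Lemma exists_exponents_of_degree (y0 : V) (c : V -> nat) :
    (\sum_y c y = d %[mod m])%N -> ((k - 1) * m.-1 <= d)%N ->
  exists2 e : V -> nat, (\sum_y e y)%N = d &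
    forall u : V -> K, (forall y, u y != 0) ->
      \prod_(y in A) u y = \prod_(y in ~: A) u y ->
    \prod_y u y ^+ e y = \prod_y u y ^+ c y.
Proof.
move=> cd kd.
have [t tm le_d] :=
  exponent_shift_small cardA cardCA (card_finField_pred_gt0 K) cd kd.
pose c' := exponent_shift A m c t; pose r := (d - \sum_y c' y)%N.
have m_r : (m %| r)%N.
  rewrite -eqn_mod_dvd // -cd eq_sym; apply/eqP.
  exact: (sum_exponent_shift_mod cardA cardCA _ (ltnW tm)).
exists (fun y => (c' y + (if y == y0 then r else 0))%N).
  rewrite big_split -big_mkcond /= big_pred1_eq.
  exact: subnKC.
move=> u u0 uA; under eq_bigr do rewrite exprD.
rewrite big_split /= [X in _ * X](bigD1 y0) //= eqxx.
rewrite [X in _ * (_ * X)]big1 ?mulr1 => [|y /negPf-> //].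
have [l ->] := dvdnP m_r; rewrite mulnC exprM expf_card_pred // expr1n mulr1.
under eq_bigr do rewrite expr_mod ?expf_card_pred // exprD.
rewrite big_split /= [X in _ * X](bigID (mem A)) /=.
rewrite [X in _ * (X * _)](eq_bigr (fun y => u y ^+ t)) => [|y ->] //.
rewrite [X in _ * (_ * X)](eq_bigr (fun y => u y ^+ (m - t))) => [|y /negPf->] //.
rewrite [X in _ * (_ * X)](eq_bigl (mem (~: A))) => [|y]; last by rewrite !inE.
rewrite !prodrXl uA -exprD subnKC ?(ltnW tm) // expf_card_pred ?mulr1 //.
exact/prodf_neq0.
Qed.

End ToricExponents.

(** * The value |X| of the Hilbert function as an interpolation property *)

Section HilbertInterpolation.
Local Open Scope ring_scope.
Variables (K : finFieldType) (s : nat).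

Lemma meval_dhomog_scale d (p : {mpoly K[s]}) (a : K) (v : 'rV[K]_s) :
  p \is d.-homog -> p.@[(a *: v) ord0] = a ^+ d * p.@[v ord0].
Proof.
move=> /dhomogP pd; rewrite !mevalE mulr_sumr; apply: eq_big_seq => n /pd /= nd.
under eq_bigr do rewrite mxE exprMn.
by rewrite big_split /= -expr_sum -mdegE nd mulrCA.
Qed.

Lemma proj_pt_refl (v : 'rV[K]_s) : v \in proj_pt v.
Proof. by apply/imsetP; exists 1; rewrite ?inE ?oner_neq0 ?scale1r. Qed.

Lemma proj_ptP (v w : 'rV[K]_s) :
  reflect (exists2 a, a != 0 & w = a *: v) (proj_pt w == proj_pt v).
Proof.
apply: (iffP eqP) => [wv | [a a0 ->]].
  by have := proj_pt_refl w; rewrite wv => /imsetP[a]; rewrite inE; exists a.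
apply/setP => u; apply/imsetP/imsetP => [][c]; rewrite inE => c0 ->.
  by exists (c * a); rewrite ?inE ?mulf_neq0 // scalerA.
by exists (c / a); rewrite ?inE ?mulf_neq0 ?invr_eq0 // scalerA divfK.
Qed.

Lemma meval_dhomog_proj_pt d (p : {mpoly K[s]}) (v w : 'rV[K]_s) :
    p \is d.-homog -> proj_pt w = proj_pt v ->
  (p.@[w ord0] == 0) = (p.@[v ord0] == 0).
Proof.
move=> pd /eqP/proj_ptP[a a0 ->].
by rewrite (meval_dhomog_scale _ _ pd) mulf_eq0 expf_eq0 (negPf a0) andbF.
Qed.

Variables (T : finType) (D : {set T}) (v : T -> 'rV[K]_s).
Let X := [set proj_pt (v x) | x in D].

Lemma vanishing_ideal_eval (p : {mpoly K[s]}) x :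
  vanishing_ideal X p -> x \in D -> p.@[v x ord0] = 0.
Proof.
move=> [l lX ->] xD; rewrite raddf_sum big_seq big1 // => hg /lX [_ hg0].
have xX : proj_pt (v x) \in X by apply: imset_f.
by rewrite /= mevalM (hg0 _ xX _ (proj_pt_refl _)) mulr0.
Qed.

Lemma exists_proj_representatives : exists r : 'I_#|X| -> T,
  [/\ forall i, r i \in D, injective (fun i => proj_pt (v (r i)))
    & forall x, x \in D -> exists i, proj_pt (v x) = proj_pt (v (r i))].
Proof.
have ex (i : 'I_#|X|) : exists x, x \in D /\ enum_val i = proj_pt (v x).
  by have /imsetP[x xD ->] := enum_valP i; exists x.
have [r rP] := fin_all_exists ex; exists r; split=> [i|i j|x xD].
- by case: (rP i).
- by case: (rP i) (rP j) => _ <- [_ <-] /enum_val_inj.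
have xX : proj_pt (v x) \in X by apply: imset_f.
pose i := enum_rank_in xX (proj_pt (v x)); exists i.
by case: (rP i) => _ <-; rewrite enum_rankK_in.
Qed.

Lemma dhomog_vanishing_ideal d (p : {mpoly K[s]}) : p \is d.-homog ->
  (forall x, x \in D -> p.@[v x ord0] = 0) -> vanishing_ideal X p.
Proof.
move=> pd p0; exists [:: (1, p)]; last by rewrite big_seq1 mul1r.
move=> hg; rewrite inE => /eqP-> /=; split; first by exists d.
move=> P /imsetP[x xD ->] w /imsetP[a _ ->].
by rewrite (meval_dhomog_scale _ _ pd) p0 ?mulr0.
Qed.

Definition interpolates d : Prop := forall x, x \in D ->
  exists p : {mpoly K[s]}, [/\ p \is d.-homog, p.@[v x ord0] != 0
    & forall y, y \in D -> proj_pt (v y) != proj_pt (v x) -> p.@[v y ord0] = 0].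

(** A form vanishing at all representatives lies in the ideal, so a basis of |X| classes has an
    invertible evaluation matrix, and the rows of its inverse give separating forms. Conversely,
    separating forms have a diagonal evaluation matrix and so form a basis. *)
Lemma hilbert_card_interpolates d : hilbert X d #|X| <-> interpolates d.
Proof.
have [r [rD r_inj r_onto]] := exists_proj_representatives.
have ideal_r p : p \is d.-homog -> (forall i, p.@[v (r i) ord0] = 0) ->
    vanishing_ideal X p.
  move=> pd p0; apply: (dhomog_vanishing_ideal pd) => x /r_onto[i xi].
  by apply/eqP; rewrite (meval_dhomog_proj_pt pd xi) p0.
split=> [[b [bd bfree _]] x xD | interp].
  pose M := \matrix_(i, j) (b i).@[v (r j) ord0].
  have homog_comb (u : 'rV_#|X|) : \sum_i u 0 i *: b i \is d.-homog.
    by apply: rpred_sum => i _; apply: dhomogZ.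
  have eval_comb (u : 'rV_#|X|) j :
      (\sum_i u 0 i *: b i).@[v (r j) ord0] = (u *m M) 0 j.
    by rewrite raddf_sum mxE; apply: eq_bigr => i _; rewrite /= mevalZ mxE.
  have freeM : row_free M.
    rewrite -kermx_eq0; apply/rowV0P => u /sub_kermxP uM0; apply/rowP => i.
    rewrite mxE; apply: (bfree (fun i => u 0 i)); apply: ideal_r => // j.
    by rewrite eval_comb uM0 mxE.
  have [i xi] := r_onto x xD; pose u := delta_mx 0 i *m invmx M : 'rV_#|X|.
  have uM : u *m M = delta_mx 0 i by rewrite mulmxKV // -row_free_unit.
  exists (\sum_i u 0 i *: b i); split=> // [|y yD yx].
    by rewrite (meval_dhomog_proj_pt (homog_comb u) xi) eval_comb uM mxE !eqxx oner_eq0.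
  have [j yj] := r_onto y yD; apply/eqP.
  rewrite (meval_dhomog_proj_pt (homog_comb u) yj) eval_comb uM mxE /=.
  have /negPf-> : j != i by apply: contraNneq yx => ji; rewrite xi yj ji.
  by [].
have [b bP] := fin_all_exists (fun i => interp _ (rD i)).
have b_diag i : (b i).@[v (r i) ord0] != 0 by case: (bP i).
have bd i : b i \is d.-homog by case: (bP i).
have eval_comb (c : 'I_#|X| -> K) j :
    (\sum_i c i *: b i).@[v (r j) ord0] = c j * (b j).@[v (r j) ord0].
  rewrite raddf_sum (bigD1 j) //= big1 ?addr0 ?mevalZ // => i ij.
  case: (bP i) => _ _ b0; rewrite mevalZ b0 ?mulr0 ?(inj_eq r_inj) // eq_sym.
  exact: ij.
exists b; split=> // [c Wc i | p pd].
  have /eqP := vanishing_ideal_eval Wc (rD i).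
  by rewrite eval_comb mulf_eq0 (negPf (b_diag i)) orbF => /eqP.
(* Lagrange interpolation at the representatives. *)
exists (fun i => p.@[v (r i) ord0] / (b i).@[v (r i) ord0]); apply: ideal_r => [|i].
  by rewrite rpredB // rpred_sum // => i _; apply: dhomogZ.
by rewrite mevalB eval_comb divfK ?subrr.
Qed.

End HilbertInterpolation.

(** * Edge values along a cycle that alternates between the two sides *)

Section CyclicMatching.
Local Open Scope ring_scope.
Variables (V : finType) (A : {set V}) (sigma : V -> V).
Hypothesis sigma_inj : injective sigma.
Hypothesis sigmaA : forall y, (sigma y \in A) = (y \notin A).

Lemma card_cyclic_bipartition k : #|V| = (2 * k)%N -> #|A| = k /\ #|~: A| = k.
Proof.
have le1 : (#|A| <= #|~: A|)%N.
  rewrite -(card_imset (mem A) sigma_inj); apply/subset_leq_card/subsetP.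
  by move=> _ /imsetP[y yA ->]; rewrite inE sigmaA negbK.
have le2 : (#|~: A| <= #|A|)%N.
  rewrite -(card_imset (mem (~: A)) sigma_inj); apply/subset_leq_card/subsetP.
  by move=> _ /imsetP[y yA ->]; rewrite sigmaA -in_setC.
by have := cardsC A; lia.
Qed.

Variable K : finFieldType.
Let m := #|K|.-1.

(** Both sides are the product of all [x y], since [sigma] exchanges [A] and its complement. *)
Lemma prod_cyclic_edges (x : V -> K) :
  \prod_(y in A) (x y * x (sigma y)) = \prod_(y in ~: A) (x y * x (sigma y)).
Proof.
rewrite !big_split /= mulrC; congr (_ * _).
  rewrite [RHS](reindex_inj sigma_inj) /=; apply: eq_bigl => y.
  by rewrite inE sigmaA negbK.
rewrite [LHS](reindex_inj sigma_inj) /=; apply: eq_bigl => y.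
by rewrite inE sigmaA.
Qed.

(** This extends a common value from the cycle edges to the chords: [phi] is [sigma]-invariant,
    hence constant on the cycle. *)
Lemma cyclic_edge_const (h : V -> K) (a : K) :
    (forall x y, fconnect sigma x y) -> (forall y, h y != 0) ->
    (forall y, h y * h (sigma y) = a) ->
  forall x y, x \in A -> y \notin A -> h x * h y = a.
Proof.
move=> conn h0 ha x y xA yA.
pose phi z := if z \in A then h z else a / h z.
have phi_inv : invariant sigma phi =1 xpredT.
  move=> z; apply/eqP; rewrite /phi sigmaA; case: (z \in A) => /=.
    by rewrite -(ha z) mulfK.
  by rewrite -(ha z) [_ / _]mulrC mulKf.
have := fconnect_invariant phi_inv (conn x y).
by rewrite /phi xA (negPf yA) => ->; rewrite divfK.
Qed.

(* For fixed y0 the sum over c of z^c z_{y0}^(d - |c|), with z_{y0}^-1 written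
   z_{y0}^(m - 1), is a product of geometric series. *)
Lemma sum_characters (u : V -> K) y0 (d : nat) : (forall y, u y != 0) ->
  \sum_(c : {ffun V -> 'I_m})
     \prod_y u y ^+ (c y + if y == y0 then d + m.-1 * \sum_z c z else 0)%N
  = u y0 ^+ d * \prod_y - (u y == u y0)%:R.
Proof.
move=> u0; transitivity (u y0 ^+ d * \sum_(c : {ffun V -> 'I_m})
    \prod_y (u y * u y0 ^+ m.-1) ^+ c y).
  rewrite mulr_sumr; apply: eq_bigr => c _; under eq_bigr do rewrite exprD.
  rewrite big_split /= [X in _ * X](bigD1 y0) //= eqxx.
  rewrite [X in _ * (_ * X)]big1 ?mulr1 => [|y /negPf-> //].
  rewrite exprD exprM expr_sum mulrCA; congr (_ * _).
  by rewrite -big_split /=; apply: eq_bigr => y _; rewrite exprMn.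
congr (_ * _).
rewrite -(bigA_distr_bigA (fun y (a : 'I_m) => (u y * u y0 ^+ m.-1) ^+ a)) /=.
have um : u y0 ^+ m.-1 = (u y0)^-1.
  apply: (mulfI (u0 y0)).
  by rewrite -exprS prednK ?card_finField_pred_gt0 // expf_card_pred ?divff.
apply: eq_bigr => y _; rewrite um geometric_sum_card_pred ?mulf_neq0 ?invr_eq0 //.
by rewrite -(inj_eq (mulIf (u0 y0))) divfK // mul1r.
Qed.

Variables (s : nat) (f : 'I_s -> {set V}).
Let torus := [set x : {ffun V -> K} | [forall y, x y != 0]].
Let point (x : {ffun V -> K}) := \row_(i < s) monom x (charvec (f i)).

Lemma monom_charvec_pair (x : {ffun V -> K}) a b : a != b ->
  monom x (charvec [set a; b]) = x a * x b.
Proof.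
move=> ab; rewrite /monom -[x b](big_set1 *%R b x) -big_setU1 ?inE //=.
rewrite [RHS]big_mkcond; apply: eq_bigr => y _; rewrite /charvec.
by case: (y \in _).
Qed.

Variable j : V -> 'I_s.
Hypothesis f_j : forall y, f (j y) = [set y; sigma y].
Hypothesis f_bip :
  forall i, exists a b, [/\ a \in A, b \notin A & f i = [set a; b]].

Lemma point_cyclic_edge x y : point x ord0 (j y) = x y * x (sigma y).
Proof.
rewrite mxE f_j monom_charvec_pair //; apply/eqP => ysy.
by have := sigmaA y; rewrite -ysy; case: (y \in A).
Qed.

Lemma interpolates_of_ge k d : #|V| = (2 * k)%N ->
    (forall x y, fconnect sigma x y) ->
  V -> ((k - 1) * m.-1 <= d)%N -> interpolates torus point d.
Proof.
move=> /card_cyclic_bipartition[cardA cardCA] conn y0 kd w.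
rewrite inE => /forallP w0.
(* The total of [ct c] is d + m|c|, congruent to d, so its monomial can be realized in degree
   exactly d. *)
pose ct (c : {ffun V -> 'I_m}) y :=
  (c y + if y == y0 then d + m.-1 * \sum_z c z else 0)%N.
have ct_d c : (\sum_y ct c y = d %[mod m])%N.
  rewrite big_split -big_mkcond /= big_pred1_eq addnCA -mulSn.
  by rewrite prednK ?card_finField_pred_gt0 // addnC mulnC modnMDl.
have [e e_deg e_eval] := fin_all_exists2 (fun c =>
  exists_exponents_of_degree cardA cardCA y0 (ct_d c) kd).
pose z (x : {ffun V -> K}) y := x y * x (sigma y).
(* The coefficients divide by values at [w], so evaluating [p] at [x] gives the character sum of the
   ratios [z x y / z w y]. *)
pose p := \sum_c (\prod_y (z w y)^-1 ^+ e c y) *: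
  'X_[\sum_y U_(j y) *+ e c y] : {mpoly K[s]}.
have evalp x : x \in torus -> p.@[point x ord0] =
    (z x y0 / z w y0) ^+ d * \prod_y - (z x y / z w y == z x y0 / z w y0)%:R.
  rewrite inE => /forallP x0.
  have u0 y : z x y / z w y != 0 by rewrite !(mulf_neq0, invr_neq0).
  rewrite -sum_characters // raddf_sum; apply: eq_bigr => c _.
  rewrite /= mevalZ -mprodXnE rmorph_prod -big_split /=.
  rewrite -e_eval //.
    apply: eq_bigr => y _; rewrite rmorphXn /= mevalXU point_cyclic_edge.
    by rewrite -exprMn mulrC.
  by rewrite !prodf_div !(prod_cyclic_edges _).
exists p; split.
- rewrite rpred_sum // => c _; apply: dhomogZ; rewrite dhomogX /=.
  rewrite mdeg_sum /=; apply/eqP; rewrite -(e_deg c); apply: eq_bigr => y _.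
  by rewrite mdegMn mdeg1 mul1n.
- rewrite evalp ?inE; last exact/forallP.
  have z0 y : z w y != 0 by rewrite mulf_neq0.
  rewrite mulf_neq0 ?expf_neq0 ?divff //; first exact: oner_neq0.
  by apply/prodf_neq0 => y _; rewrite !divff // eqxx oppr_eq0 oner_eq0.
move=> x xT; have := xT; rewrite inE => /forallP x0 xw; rewrite evalp //.
apply: contraNeq xw; rewrite mulf_eq0 negb_or => /andP[_ /prodf_neq0 all_eq].
set a := z x y0 / z w y0 in all_eq.
have a0 : a != 0 by rewrite !(mulf_neq0, invr_neq0).
apply/proj_ptP; exists a => //; apply/rowP => i; rewrite !mxE.
have [b [c [bA cA ->]]] := f_bip i.
rewrite !monom_charvec_pair; try by apply: contraNneq cA => <-.
(* A nonzero value of [p] makes all cycle-edge ratios equal to [a]; chords then have ratio [a] too,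
   so [x] and [w] give the same point. *)
have : (x b / w b) * (x c / w c) = a.
  apply: (cyclic_edge_const (h := fun y => x y / w y) conn) => // y.
    by rewrite mulf_neq0 ?invr_neq0.
  have := all_eq y isT; rewrite oppr_eq0.
  have [ya _|_] := eqVneq (z x y / z w y) a; last by rewrite eqxx.
  by rewrite -ya /z invfM mulrACA.
by move=> <-; rewrite mulf_div divfK // mulf_neq0.
Qed.

(** Every edge has exactly one endpoint in [A]. *)
Lemma sum_degrees_side (n : 'X_{1..s}) :
  (\sum_(y in A) \sum_i charvec (f i) y * n i)%N = mdeg n.
Proof.
rewrite exchange_big mdegE /=; apply: eq_bigr => i _; rewrite -big_distrl /=.
have [a [b [aA bA ->]]] := f_bip i; rewrite (bigD1 a) //= big1 => [|y].
  by rewrite /charvec !inE eqxx addn0 mul1n.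
move=> /andP[yA /negPf ya]; rewrite /charvec !inE ya /=.
by case: eqP yA => // ->; rewrite (negPf bA).
Qed.

(** * Lower bound by a weighted sum over a slice of the torus *)

Lemma sum_slice_eq0 a0 d (p : {mpoly K[s]}) : a0 \in A -> p \is d.-homog ->
    (d < #|A|.-1 * m.-1)%N ->
  \sum_(x in family (fun y (u : K) => if y \in A :\ a0 then u != 0 else u == 1))
     (\prod_(y in A :\ a0) x y) * p.@[point x ord0] = 0.
Proof.
move=> a0A pd dlt; under eq_bigr do rewrite mevalE mulr_sumr.
rewrite exchange_big /= big_seq big1 // => n np.
pose deg y := (\sum_i charvec (f i) y * n i)%N.
have nd : mdeg n = d by move/dhomogP: pd => /(_ n np).
transitivity (p@_n * \sum_(x in family
    (fun y (u : K) => if y \in A :\ a0 then u != 0 else u == 1))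
    \prod_y x y ^+ ((y \in A :\ a0) + deg y)%N).
  rewrite mulr_sumr; apply: eq_bigr => x _; rewrite mulrCA; congr (_ * _).
  under [RHS]eq_bigr do rewrite exprD.
  rewrite big_split /=; congr (_ * _).
    by rewrite big_mkcond; apply: eq_bigr => y _; case: (y \in _).
  under [RHS]eq_bigr do rewrite expr_sum.
  rewrite exchange_big; apply: eq_bigr => i _; rewrite mxE -prodrXl.
  by apply: eq_bigr => y _; rewrite exprM.
rewrite -(bigA_distr_big_dep _ (fun y (u : K) => u ^+ ((y \in A :\ a0) + deg y)%N)).
(* The sum now factors over vertices. If [m] divided every [1 + deg y], each [deg y] would be at
   least m - 1 and the degree would exceed d; so some factor is a vanishing power sum. *)
have [y yA my] : exists2 y, y \in A :\ a0 & ~~ (m %| (1 + deg y))%N.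
  apply/exists_inP; apply: contraTT dlt => /exists_inPn /= dvd.
  rewrite -leqNgt -nd -sum_degrees_side (cardsD1 a0) a0A -sum_nat_const.
  rewrite [X in (_ <= X)%N](big_setD1 a0) //=; apply: leq_trans (leq_addl _ _).
  apply: leq_sum => y /dvd /negPn /dvdn_leq; rewrite -/(deg y); lia.
by rewrite (bigD1 y) //= yA sum_expf_unit ?mul0r ?mulr0.
Qed.

Lemma ge_of_interpolates d : V ->
  interpolates torus point d -> (#|A|.-1 * m.-1 <= d)%N.
Proof.
move=> y0 interp; rewrite leqNgt; apply/negP => dlt.
have [a0 a0A] : exists a0, a0 \in A.
  by case y0A : (y0 \in A); [exists y0 | exists (sigma y0); rewrite sigmaA y0A].
pose one : {ffun V -> K} := [ffun=> 1].
have torus1 : one \in torus.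
  by rewrite inE; apply/forallP => y; rewrite ffunE oner_neq0.
have [p [pd p1 p0]] := interp one torus1.
have := sum_slice_eq0 a0A pd dlt; rewrite (bigD1 one) /=; last first.
  by apply/familyP => y; rewrite ffunE !unfold_in oner_neq0 eqxx if_same.
rewrite [X in _ + X]big1 => [/eqP|x /andP[/familyP xfam x1]].
  rewrite addr0 big1 => [|y _]; last by rewrite ffunE.
  by rewrite mul1r (negPf p1).
have xQ y : if y \in A :\ a0 then x y != 0 else x y == 1 by apply: xfam.
have xoff y : y \notin A :\ a0 -> x y = 1.
  by move=> /negPf yA; have := xQ y; rewrite yA => /eqP.
have xT : x \in torus.
  rewrite inE; apply/forallP => y; have := xQ y.
  by case: (y \in _) => // /eqP ->; exact: oner_neq0.
rewrite p0 ?mulr0 //; apply: contraNneq x1 => /eqP /proj_ptP[a _ xa].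
(* The successor of a vertex of [A] lies off [A], where [x] is 1, so cycle edges force [x = a] on
   [A]; then [x a0 = 1] gives a = 1. *)
have edge y : y \in A -> x y = a.
  move=> yA; have := point_cyclic_edge x y.
  rewrite xa mxE point_cyclic_edge !ffunE !mulr1 => ->.
  by rewrite [x (sigma y)]xoff ?mulr1 // !inE sigmaA yA andbF.
have a1 : a = 1 by rewrite -(edge a0) // xoff // !inE eqxx.
apply/eqP/ffunP => y; rewrite ffunE; case yA : (y \in A).
  by rewrite edge.
by rewrite xoff // !inE yA andbF.
Qed.

End CyclicMatching.

(** * From the Hamiltonian cycle to the successor map and the regularity *)

Theorem corollary2p21 (K : finFieldType) (q : nat) (cardK : #|K| = q)
    (q_neq2 : q <> 2)
    (V : finType) (adj : rel V)
    (adj_sym : symmetric adj) (adj_irr : irreflexive adj)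
    (k : nat) (cardV : #|V| = 2 * k)
    (ham : hamiltonian adj) (bip : bipartite adj)
    (* f enumerates the edges of the graph without repetition *)
    (s : nat) (f : 'I_s -> {set V}) (f_inj : injective f)
    (f_edges : forall A : {set V}, (A \in edges adj) = (A \in codom f)) :
  regularity (toric_set K f) ((k - 1) * (q - 2)).
Proof.
have [[|y0 c'] [// _ cyc uniq_c mem_c]] := ham; move: cyc uniq_c mem_c.
set c := y0 :: c' => cyc uniq_c mem_c.
have [A bipA] := bip; pose sigma := next c.
have sigma_inj : injective sigma := can_inj (prev_next uniq_c).
have adj_sigma y : adj y (sigma y) by apply: next_cycle.
have sigmaA y : (sigma y \in A) = (y \notin A).
  by have := bipA _ _ (adj_sigma y); do 2!case: (_ \in A).
have conn x y : fconnect sigma x y.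
  by rewrite (fconnect_cycle (cycle_next uniq_c)).
have ex_j y : exists i, f i = [set y; sigma y].
  have /codomP[i ->] : [set y; sigma y] \in codom f; last by exists i.
  by rewrite -f_edges; apply/imsetP; exists (y, sigma y); rewrite ?inE.
have [j f_j] := fin_all_exists ex_j.
have f_bip i : exists a b, [/\ a \in A, b \notin A & f i = [set a; b]].
  have : f i \in edges adj by rewrite f_edges codom_f.
  case/imsetP => -[a b]; rewrite inE /= => /bipA; case aA: (a \in A) => /= bA fi.
    by exists a, b; rewrite aA; split=> //; move: bA; case: (_ \in A).
  exists b, a; rewrite aA fi setUC; split=> //.
  by move: bA; case: (_ \in A).
(* [toric_set] is by definition the image of the torus under the edge monomials, so the
   interpolation criterion applies directly. *)
have hilb d := hilbert_card_interpolates
  [set x : {ffun V -> K} | [forall y, x y != 0%R]]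
  (fun x => (\row_(i < s) monom x (charvec (f i)))%R) d.
have [cardA _] := card_cyclic_bipartition sigma_inj sigmaA cardV.
have q2 : q - 2 = #|K|.-1.-1 by rewrite cardK; lia.
rewrite q2; split=> [d kd | p stable].
  apply/hilb.
  exact: (interpolates_of_ge sigma_inj sigmaA f_j f_bip cardV conn y0).
have /hilb := stable p (leqnn p).
by move/(ge_of_interpolates sigmaA f_j f_bip y0); rewrite cardA -subn1.
Qed.
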